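(* Let $k$ be a field, $S=k[x_1,\ldots,x_n]$, and $d\ge2$ an integer. Let $I=(\mathcal L(u,v))$ be a lexsegment ideal defined by the monomials of degree $d$, $u=x_1x_l^{a_l}\cdots x_n^{a_n}$ and $v=x_q^{b_q}\cdots x_n^{b_n}$, where $a_l,b_q>0$, $l,q\ge2$ and $x_nu/x_1<_{lex}v$. Then the following statements hold: (a) If $v=x_2^d$ and $l\ge4$, then $\mathrm{depth}(S/I)=l-2$. (b) If $v=x_2^{d-1}x_j$ for some $3\le j\le n-2$ and $l\ge j+2$, then $\mathrm{depth}(S/I)=l-j$. (c) $\mathrm{depth}(S/I)=1$ in all the other cases.
   Context: Lexicographic order is taken with $x_1>\cdots>x_n$. $\mathcal L(u,v)$ is the set of all monomials $w$ of degree $d$ of $S$ with $u\ge_{lex}w\ge_{lex}v$, and $(\mathcal L(u,v))$ is the ideal of $S$ it generates. Depth is taken with respect to the graded maximal ideal $(x_1,\ldots,x_n)$. *)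

(* Defs.v *)
From mathcomp Require Import all_boot all_order all_algebra.
From mathcomp Require Export mpoly.

Set Implicit Arguments.
Unset Strict Implicit.
Unset Printing Implicit Defensive.

Import Order.TTheory GRing.Theory.
Local Open Scope ring_scope.

Section Depth.

Variable R : comNzRingType.
Implicit Types (G I m : R -> Prop) (s : seq R).

Definition ideal_gen G : R -> Prop :=
  fun p => exists2 c : seq (R * R),
    (forall t, t \in c -> G t.2) & p = \sum_(t <- c) t.1 * t.2.

(* The ideal I + (s). *)
Definition ideal_adjoin I s : R -> Prop :=
  ideal_gen (fun p => I p \/ p \in s).

(* s = f_1, ..., f_r is a regular sequence on R/I: each f_i is a nonzerodivisor
   on R/(I + (f_1, ..., f_(i-1))), and R/(I + (s)) is nonzero.  Vanishing of a
   class in the quotient is written as membership of a representative. *)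
Definition regular_on_quotient I s : Prop :=
  (forall (i : nat) (g : R), (i < size s)%N ->
     ideal_adjoin I (take i s) (s`_i * g) -> ideal_adjoin I (take i s) g)
  /\ ~ ideal_adjoin I s 1.

(* r is the depth of R/I with respect to the ideal m: the maximal length of a
   sequence of elements of m that is regular on R/I. *)
Definition is_depth_quotient m I (r : nat) : Prop :=
  (exists s, [/\ forall f, f \in s -> m f, regular_on_quotient I s
               & size s = r])
  /\ (forall s, (forall f, f \in s -> m f) -> regular_on_quotient I s ->
        (size s <= r)%N).

End Depth.

(* Exponent vector of x_i, with 1-based i: the ordinal j : 'I_n indexes the
   variable x_(j+1).  Monomials are represented by their exponent vectors, so
   products and powers of monomials are written +%MM and *+%MM. *)
Definition xm (n i : nat) : 'X_{1..n} := [multinom (j.+1 == i : nat) | j < n].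

(* Lexicographic order with x_1 > ... > x_n; the order that mpoly declares on
   'X_{1..n} compares total degrees first. *)
Definition lex_le (n : nat) (w1 w2 : 'X_{1..n}) : bool :=
  ((val w1 : n.-tuplelexi nat) <= (val w2 : n.-tuplelexi nat))%O.

Definition lex_lt (n : nat) (w1 w2 : 'X_{1..n}) : bool :=
  ((val w1 : n.-tuplelexi nat) < (val w2 : n.-tuplelexi nat))%O.

Definition lexseg (n d : nat) (u v w : 'X_{1..n}) : bool :=
  [&& mdeg w == d, lex_le w u & lex_le v w].

Definition lexseg_ideal (k : fieldType) (n d : nat) (u v : 'X_{1..n}) :
    {mpoly k[n]} -> Prop :=
  ideal_gen (fun p => exists2 w, lexseg d u v w & p = 'X_[w]).
Arguments lexseg_ideal k {n} d u v _.

Definition graded_max_ideal (k : fieldType) (n : nat) : {mpoly k[n]} -> Prop :=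
  ideal_gen (fun p => exists i : 'I_n, p = 'X_i).
Arguments graded_max_ideal k n _ : clear implicits.

(* depth (S/I) = r, for S = k[x_1, ..., x_n]. *)
Definition depth_is (k : fieldType) (n : nat) (I : {mpoly k[n]} -> Prop)
    (r : nat) : Prop :=
  is_depth_quotient (graded_max_ideal k n) I r.

(* Main.v *)
(* Write A = k[x_2, ..., x_n] and u' = u / x_1.  Then I = x_1 J + V, where J is
   generated by the monomials w <= u' of degree d - 1 of A and V by the
   monomials w >= v of degree d of A.

   Lower bounds: the hypothesis x_n u' < v makes x_1 - x_n regular on S/I, and if
   v = x_2^(d-1) x_j then no generator of I involves x_(j+1), ..., x_(l-1).

   Upper bounds: multiplication by an element of (x_1, ..., x_n) is null-homotopic
   on the Koszul complex of the variables.  Hence if H^r(S/I) <> 0, then dividing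
   out a regular sequence of length r leaves H^0 <> 0, that is, a socle element,
   and no regular sequence is longer.  Nonzero classes are z e_1 e_(j+1) ... e_(l-1)
   for a monomial z killed mod I by the remaining variables: z = x_2^(d-1) if
   v <= x_2^(d-1) x_n, z = u / x_2 if l = 2, and otherwise v = x_2^(d-1) x_j and
   z = x_1 x_2^(d-1) m with m = u' / x_l if j < l, m = x_n^(d-2) if l <= j. *)
Require Import Defs.
From mathcomp Require Import all_boot all_order all_algebra.
From mathcomp Require Import zify ring.

Set Implicit Arguments.
Unset Strict Implicit.
Unset Printing Implicit Defensive.

Import Order.TTheory GRing.Theory.

(** * Ideals and their generators *)

Section Ideals.
Local Open Scope ring_scope.
Variable R : comNzRingType.
Implicit Types (G I J : R -> Prop) (s : seq R).

Record is_ideal I : Prop := IsIdeal {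
  ideal0 : I 0;
  idealD : forall p q, I p -> I q -> I (p + q);
  idealMl : forall p q, I q -> I (p * q) }.

Lemma idealN I p : is_ideal I -> I p -> I (- p).
Proof. by move=> hI Ip; rewrite -mulN1r; apply: idealMl. Qed.

Lemma idealB I p q : is_ideal I -> I p -> I q -> I (p - q).
Proof. by move=> hI Ip Iq; apply: idealD => //; apply: idealN. Qed.

Lemma ideal_sum (T : eqType) I (r : seq T) (F : T -> R) :
  is_ideal I -> (forall t, t \in r -> I (F t)) -> I (\sum_(t <- r) F t).
Proof.
move=> hI hF; rewrite big_seq.
by elim/big_ind: _ => //; [apply: ideal0 | apply: idealD].
Qed.

Lemma ideal_gen_ideal G : is_ideal (ideal_gen G).
Proof.
split; first by exists [::]; rewrite ?big_nil.
- move=> p q [c hc ->] [e he ->]; exists (c ++ e); last by rewrite big_cat.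
  by move=> t; rewrite mem_cat => /orP[/hc|/he].
- move=> p q [c hc ->]; exists [seq (p * t.1, t.2) | t <- c].
    by move=> t /mapP[t' /hc ? ->].
  by rewrite big_map mulr_sumr; apply: eq_bigr => t _; rewrite mulrA.
Qed.

Lemma ideal_gen_incl G p : G p -> ideal_gen G p.
Proof.
by exists [:: (1, p)]; rewrite ?big_seq1 ?mul1r // => t; rewrite inE => /eqP->.
Qed.

Lemma ideal_gen_sub G J :
  is_ideal J -> (forall p, G p -> J p) -> forall p, ideal_gen G p -> J p.
Proof.
move=> hJ hG p [c hc ->]; apply: ideal_sum => // t /hc/hG.
exact: idealMl.
Qed.

Lemma ideal_adjoin_ideal I s : is_ideal (ideal_adjoin I s).
Proof. exact: ideal_gen_ideal. Qed.

Lemma ideal_adjoin_sub I J s :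
  is_ideal J -> (forall p, I p -> J p) -> (forall p, p \in s -> J p) ->
  forall p, ideal_adjoin I s p -> J p.
Proof. by move=> hJ hI hs; apply: ideal_gen_sub => // p [/hI|/hs]. Qed.

Lemma ideal_adjoin_inclI I s p : I p -> ideal_adjoin I s p.
Proof. by move=> Ip; apply: ideal_gen_incl; left. Qed.

Lemma ideal_adjoin_incl I s p : p \in s -> ideal_adjoin I s p.
Proof. by move=> ps; apply: ideal_gen_incl; right. Qed.

Lemma ideal_adjoin0 I p : is_ideal I -> ideal_adjoin I [::] p <-> I p.
Proof.
by move=> hI; split; [apply: ideal_adjoin_sub | apply: ideal_adjoin_inclI].
Qed.

(** Gives the adjunction of a last element the shape in which [koszul_nonzero_regular] divides out a
    single [f]. *)
Lemma ideal_adjoin_rcons I s f p :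
  ideal_adjoin I (rcons s f) p <-> exists g, ideal_adjoin I s (p - g * f).
Proof.
have hs := ideal_adjoin_ideal I s; split; last first.
  case=> g hg; rewrite -(subrK (g * f) p); apply: idealD.
  - exact: ideal_adjoin_ideal.
  - apply: ideal_adjoin_sub hg; first exact: ideal_adjoin_ideal.
      by move=> q; apply: ideal_adjoin_inclI.
    by move=> q qs; apply: ideal_adjoin_incl; rewrite mem_rcons inE qs orbT.
  - apply: idealMl; first exact: ideal_adjoin_ideal.
    by apply: ideal_adjoin_incl; rewrite mem_rcons inE eqxx.
apply: (@ideal_adjoin_sub _ (fun p => exists g, ideal_adjoin I s (p - g * f))).
- split; first by exists 0; rewrite mul0r subr0; apply: ideal0.
  + move=> p1 p2 [g1 h1] [g2 h2]; exists (g1 + g2).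
    have -> : p1 + p2 - (g1 + g2) * f = (p1 - g1 * f) + (p2 - g2 * f) by ring.
    exact: idealD.
  + move=> p1 p2 [g h]; exists (p1 * g).
    by rewrite -mulrA -mulrBr; apply: idealMl.
- by move=> q Iq; exists 0; rewrite mul0r subr0; apply: ideal_adjoin_inclI.
- move=> q; rewrite mem_rcons inE => /orP[/eqP->|qs].
    by exists 1; rewrite mul1r subrr; apply: ideal0.
  by exists 0; rewrite mul0r subr0; apply: ideal_adjoin_incl.
Qed.

End Ideals.

(** * Koszul cohomology and regular sequences *)

Section Koszul.
Local Open Scope ring_scope.
Variables (R : comNzRingType) (T : eqType) (X : T -> R).
Implicit Types (I : R -> Prop) (xs : seq T) (c z : bitseq -> R) (s : bitseq).

(* Koszul cochains on the sequence [X x], x in xs: a bit sequence of the length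
   of xs stands for the exterior monomial it selects, and the recursion is the
   mapping cone construction. *)
Fixpoint koszul_diff xs c s : R :=
  match xs, s with
  | _ :: xs', false :: s' => koszul_diff xs' (fun t => c (false :: t)) s'
  | x :: xs', true :: s' =>
      X x * c (false :: s') - koszul_diff xs' (fun t => c (true :: t)) s'
  | _, _ => 0
  end.

(** Interior product with the functional taking the generator of [x] to [g x]; the minus sign comes
    from passing over a generator. *)
Fixpoint koszul_contraction (g : T -> R) xs c s : R :=
  match xs, s with
  | x :: xs', false :: s' =>
      g x * c (true :: s')
      + koszul_contraction g xs' (fun t => c (false :: t)) s'
  | _ :: xs', true :: s' =>
      - koszul_contraction g xs' (fun t => c (true :: t)) s'
  | _, _ => 0
  end.

Lemma koszul_diff_ext xs c c' s :
  c =1 c' -> koszul_diff xs c s = koszul_diff xs c' s.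
Proof.
elim: xs c c' s => [|x xs IH] c c' [|[] s] e //=.
  by rewrite e; congr (_ - _); apply: IH => t; rewrite e.
by apply: IH => t; rewrite e.
Qed.

Lemma koszul_diff_lin xs a c c' s :
  koszul_diff xs (fun t => a * c t + c' t) s =
  a * koszul_diff xs c s + koszul_diff xs c' s.
Proof.
elim: xs c c' s => [|x xs IH] c c' [|[] s] /=; rewrite ?mulr0 ?addr0 //.
by rewrite IH; ring.
Qed.

Lemma koszul_diff0 xs c s : (forall t, c t = 0) -> koszul_diff xs c s = 0.
Proof.
elim: xs c s => [|x xs IH] c [|[] s] //= c0; last exact: IH.
by rewrite c0 mulr0 IH ?subr0.
Qed.

Lemma koszul_diffK xs c s : koszul_diff xs (koszul_diff xs c) s = 0.
Proof.
elim: xs c s => [|x xs IH] c [|[] s] //=.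
set cf := fun t => c (false :: t); set ct := fun t => c (true :: t).
(* The factor [- 1] and the summand [0] match the shape [a * c t + c' t] of the linearity lemma,
   applied twice. *)
rewrite [X in _ - X](koszul_diff_ext _ _ (c' := fun t =>
  X x * cf t + (- 1 * koszul_diff xs ct t + 0))); last first.
  by move=> t /=; rewrite -/ct -/(cf t); ring.
by rewrite !koszul_diff_lin IH (@koszul_diff0 xs (fun=> 0)) //; ring.
Qed.

Lemma koszul_contraction_ext g xs c c' s :
  c =1 c' -> koszul_contraction g xs c s = koszul_contraction g xs c' s.
Proof.
elim: xs c c' s => [|x xs IH] c c' [|[] s] e //=.
  by congr (- _); apply: IH => t; rewrite e.
by rewrite e; congr (_ + _); apply: IH => t; rewrite e.
Qed.

Lemma koszul_contraction_lin g xs a c c' s :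
  koszul_contraction g xs (fun t => a * c t + c' t) s =
  a * koszul_contraction g xs c s + koszul_contraction g xs c' s.
Proof.
elim: xs c c' s => [|x xs IH] c c' [|[] s] /=; rewrite ?mulr0 ?addr0 // IH;
by ring.
Qed.

(** Induction on [xs]: the mixed terms of the two composites cancel by sign, and the head [x] leaves
    [g x * X x] times the cochain. *)
Lemma koszul_homotopy g xs c s : size s = size xs ->
  koszul_diff xs (koszul_contraction g xs c) s
  + koszul_contraction g xs (koszul_diff xs c) s
  = (\sum_(x <- xs) g x * X x) * c s.
Proof.
elim: xs c s => [|x xs IH] c [|[] s] //= sz.
- by rewrite big_nil mul0r addr0.
- rewrite big_cons mulrDl; case: sz => sz.
  set cf := fun t => c (false :: t); set ct := fun t => c (true :: t).
  rewrite -/(ct s) -(IH ct s sz).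
  rewrite (koszul_diff_ext _ _ (c' := fun t =>
     (- 1) * koszul_contraction g xs ct t + 0)); last first.
    by move=> t /=; rewrite -/ct -/(cf t); ring.
  rewrite koszul_diff_lin (@koszul_diff0 xs (fun=> 0)) //.
  rewrite [X in _ - X](koszul_contraction_ext _ _ _ (c' := fun t =>
     (- 1) * koszul_diff xs ct t + (X x * cf t + 0))); last first.
    by move=> t; rewrite /= -/ct -/(cf t); ring.
  rewrite !koszul_contraction_lin.
  have -> : koszul_contraction g xs (fun=> 0) s = 0.
    by elim: (xs) (s) => [|y ys IHy] [|[] r] //=; rewrite ?IHy ?mulr0 ?oppr0 ?addr0.
  by ring.
- rewrite big_cons mulrDl; case: sz => sz.
  set cf := fun t => c (false :: t); set ct := fun t => c (true :: t).
  rewrite -/(cf s) -(IH cf s sz) koszul_diff_lin.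
  by ring.
Qed.

Lemma koszul_diff_mem I xs c s : is_ideal I -> size s = size xs ->
  (forall t, size t = size xs -> I (c t)) -> I (koszul_diff xs c s).
Proof.
move=> hI; elim: xs c s => [|x xs IH] c [|[] s] //= sz hc; first exact: ideal0.
- case: sz => sz; apply: idealB => //.
    by apply: idealMl => //; apply: hc; rewrite /= sz.
  by apply: IH => // t tsz; apply: hc; rewrite /= tsz.
- case: sz => sz; by apply: IH => // t tsz; apply: hc; rewrite /= tsz.
Qed.

Lemma koszul_contraction_mem I g xs c s : is_ideal I -> size s = size xs ->
  (forall t, size t = size xs -> I (c t)) -> I (koszul_contraction g xs c s).
Proof.
move=> hI; elim: xs c s => [|x xs IH] c [|[] s] //= sz hc; first exact: ideal0.
- case: sz => sz; apply: idealN => //.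
  by apply: IH => // t tsz; apply: hc; rewrite /= tsz.
- case: sz => sz; apply: idealD => //.
    by apply: idealMl => //; apply: hc; rewrite /= sz.
  by apply: IH => // t tsz; apply: hc; rewrite /= tsz.
Qed.

(** The offset [k] counts the generators selected in the prefix already stripped off, so that the
    induction keeps the total degree [i] fixed. *)
Lemma koszul_contraction_deg k i g xs c s :
  (forall t, (k + count id t)%N <> i -> c t = 0) ->
  (k + (count id s).+1)%N <> i -> koszul_contraction g xs c s = 0.
Proof.
elim: xs k c s => [|x xs IH] k c [|[] s] //= c0 ki.
  rewrite (IH k.+1) ?oppr0 //; last by lia.
  by move=> t kt; apply: c0; rewrite /=; lia.
rewrite c0 ?mulr0 ?add0r; last by rewrite /=; lia.
by apply: (IH k) => // t kt; apply: c0; rewrite /=; lia.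
Qed.

Definition koszul_coboundary I xs z : Prop :=
  exists t, forall s, size s = size xs -> I (z s - koszul_diff xs t s).

(* Nonvanishing of the i-th Koszul cohomology of R/I.  Only [z] is required to
   be homogeneous; replacing [t] by its component of degree i - 1 shows that
   this does not change the notion. *)
Definition koszul_nonzero I xs (i : nat) : Prop :=
  exists z, [/\ forall s, count id s <> i -> z s = 0,
    forall s, size s = size xs -> I (koszul_diff xs z s)
    & ~ koszul_coboundary I xs z].

Lemma koszul_nonzero_ext I J xs i : (forall p, I p <-> J p) ->
  koszul_nonzero I xs i -> koszul_nonzero J xs i.
Proof.
move=> IJ [z [z1 z2 z3]]; exists z; split=> // [s /z2/IJ //|[t ht]].
by apply: z3; exists t => s /ht/IJ.
Qed.

(** A choice principle, provable by induction on the length because only finitely many bit sequences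
    matter. *)
Lemma bitseq_choice (P : bitseq -> R -> Prop) m :
  (forall s, size s = m -> exists g, P s g) ->
  exists y, forall s, size s = m -> P s (y s).
Proof.
elim: m P => [|m IH] P hP.
  have [g hg] := hP [::] erefl; exists (fun=> g) => s /size0nil -> //.
have [|yt ht] := IH (fun s => P (true :: s)).
  by move=> s sz; apply: hP; rewrite /= sz.
have [|yf hf] := IH (fun s => P (false :: s)).
  by move=> s sz; apply: hP; rewrite /= sz.
exists (fun s => if head true s then yt (behead s) else yf (behead s)).
by case=> [//|[] s [sz]]; [apply: ht | apply: hf].
Qed.

(* An element of the ideal of the [X x] acts as zero on Koszul cohomology, so
   the connecting map H^i(R/(I + f)) -> H^(i+1)(R/I) is onto. *)
Lemma koszul_nonzero_regular I xs g f i :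
  is_ideal I -> f = \sum_(x <- xs) g x * X x ->
  (forall p, I (f * p) -> I p) -> koszul_nonzero I xs i.+1 ->
  koszul_nonzero (fun p => exists h, I (p - h * f)) xs i.
Proof.
move=> hI fE freg [z [zdeg zcyc zcob]].
(* By the homotopy formula its differential is [f * z] modulo [I], so the connecting map sends its
   class to that of [z]. *)
exists (koszul_contraction g xs z); split.
- by move=> s si; apply: (@koszul_contraction_deg 0%N i.+1) => // [[]].
- move=> s sz; exists (z s).
  rewrite mulrC fE -koszul_homotopy // opprD addrA subrr add0r.
  by apply: idealN => //; apply: koszul_contraction_mem.
- case=> t ht; apply: zcob.
  (* Here [y] collects the multiples of [f], so [e] takes values in [I]; applying the differential
     to [e] puts [f * (z - d y)] in [I], and [f] cancels. *)
  have [y hy] := bitseq_choice ht; exists y => s sz; apply: freg.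
  set e := fun s => koszul_contraction g xs z s - koszul_diff xs t s - y s * f.
  have -> : f * (z s - koszul_diff xs y s) =
      koszul_diff xs e s + koszul_contraction g xs (koszul_diff xs z) s.
    rewrite mulrBr {1}fE -koszul_homotopy //.
    rewrite [in RHS](koszul_diff_ext _ _ (c' := fun s => (- f) * y s +
       ((- 1) * koszul_diff xs t s + koszul_contraction g xs z s))); last first.
      by move=> r; rewrite /e; ring.
    by rewrite !koszul_diff_lin koszul_diffK; ring.
  by apply: idealD; [|apply: koszul_diff_mem|apply: koszul_contraction_mem].
Qed.

(** A cochain of degree 0 has zero contraction, so the homotopy formula puts [f * z] in [I];
    cancelling [f] would put [z] in [I] and make its class zero. *)
Lemma koszul_nonzero0_nonregular I xs g f :
  is_ideal I -> f = \sum_(x <- xs) g x * X x ->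
  koszul_nonzero I xs 0 -> ~ (forall p, I (f * p) -> I p).
Proof.
move=> hI fE [z [zdeg zcyc zcob]] freg; apply: zcob.
exists (fun=> 0) => s sz; rewrite koszul_diff0 // subr0; apply: freg.
rewrite fE -koszul_homotopy // koszul_diff0 ?add0r.
  exact: koszul_contraction_mem.
by move=> t; apply: (@koszul_contraction_deg 0%N 0%N).
Qed.

Lemma koszul_depth_bound I xs r (fs : seq R) :
  is_ideal I -> koszul_nonzero I xs r ->
  (forall f, f \in fs -> exists g, f = \sum_(x <- xs) g x * X x) ->
  regular_on_quotient I fs -> (size fs <= r)%N.
Proof.
move=> hI nz sm [sreg _].
have step i : (i <= r)%N -> (i <= size fs)%N ->
    koszul_nonzero (ideal_adjoin I (take i fs)) xs (r - i).
  elim: i => [_ _|i IH ir ifs].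
    rewrite take0 subn0; apply: koszul_nonzero_ext nz => p.
    by rewrite ideal_adjoin0.
  have [g fE] := sm fs`_i (mem_nth 0 ifs).
  have : koszul_nonzero (ideal_adjoin I (take i fs)) xs (r - i.+1).+1.
    by rewrite subnSK //; apply: IH; apply: ltnW.
  move/(koszul_nonzero_regular (ideal_adjoin_ideal _ _) fE).
  move=> /(_ (fun p => @sreg i p ifs)); apply: koszul_nonzero_ext => p.
  by rewrite (take_nth 0) // ideal_adjoin_rcons.
(* An element beyond the first [r] would be regular on a quotient whose cohomology of degree 0 is
   nonzero. *)
rewrite leqNgt; apply/negP => rs.
have [g fE] := sm fs`_r (mem_nth 0 rs).
have := step r (leqnn r) (ltnW rs); rewrite subnn.
move/(koszul_nonzero0_nonregular (ideal_adjoin_ideal _ _) fE); apply.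
by move=> p; apply: sreg.
Qed.

(** Left exterior multiplication by the generator of the first entry of the sequence. *)
Definition koszul_wedge z s : R := if s is true :: s' then z s' else 0.

(** [X x] vanishes modulo [J], so in the components containing the generator of [x] only minus the
    differential of [t (true :: _)] remains; hence the sign in the witness. *)
Lemma koszul_wedge_coboundary I J x xs z :
  is_ideal J -> (forall p, I p -> J p) -> J (X x) ->
  koszul_coboundary I (x :: xs) (koszul_wedge z) -> koszul_coboundary J xs z.
Proof.
move=> hJ IJ Jx [t ht].
exists (fun s => (- 1) * t (true :: s) + 0) => s sz.
have /ht/IJ /= Jt : size (true :: s) = size (x :: xs) by rewrite /= sz.
rewrite koszul_diff_lin (@koszul_diff0 xs (fun=> 0)) //.
set a := koszul_diff _ _ _ in Jt *.
have -> : z s - (- 1 * a + 0) =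
    (z s - (X x * t (false :: s) - a)) + t (false :: s) * X x.
  by ring.
by apply: idealD => //; apply: idealMl.
Qed.

Lemma koszul_wedge_cocycle I x xs z : is_ideal I ->
  (forall s, size s = size xs -> I (koszul_diff xs z s)) ->
  forall s, size s = size (x :: xs) -> I (koszul_diff (x :: xs) (koszul_wedge z) s).
Proof.
move=> hI hz [|[] s] //= [sz]; last first.
  by rewrite koszul_diff0 //; apply: ideal0.
by rewrite mulr0 sub0r; apply: idealN => //; apply: hz.
Qed.

(** [has id s] fails exactly when [s] selects no generator, so this is the scalar [p] in degree
    0. *)
Definition koszul_const p s : R := if has id s then 0 else p.

Lemma koszul_const_cocycle I xs p s : is_ideal I ->
  (forall x, x \in xs -> I (X x * p)) -> size s = size xs ->
  I (koszul_diff xs (koszul_const p) s).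
Proof.
move=> hI; elim: xs s => [|x xs IH] [|[] s] //= hp sz; first exact: ideal0.
- rewrite (@koszul_diff0 xs (fun=> 0)) // subr0 /koszul_const /=.
  case: has; first by rewrite mulr0; apply: ideal0.
  by apply: hp; rewrite mem_head.
- case: sz => sz; apply: IH => // y yxs.
  by apply: hp; rewrite inE yxs orbT.
Qed.

(* Reading off the coefficients of weight 0 and 1 of the cobounding cochain. *)
Lemma koszul_wedge_const_coboundary I x xs p :
  koszul_coboundary I (x :: xs) (koszul_wedge (koszul_const p)) ->
  exists q, I (p - X x * q) /\ forall y, y \in xs -> I (- (X y * q)).
Proof.
have diff_weight0 ys c : koszul_diff ys c (nseq (size ys) false) = 0.
  by elim: ys c => //= y ys IH c; apply: IH.
have diff_weight1 ys c : (forall s, size s = size ys -> I (- koszul_diff ys c s)) ->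
    forall y, y \in ys -> I (- (X y * c (nseq (size ys) false))).
  elim: ys c => [//|y' ys IH] c hc y; rewrite inE => /orP[/eqP->|yys].
    have /= := hc (true :: nseq (size ys) false).
    by rewrite size_nseq => /(_ erefl); rewrite diff_weight0 subr0.
  apply: (IH (fun r => c (false :: r))) => // s sz.
  by apply: (hc (false :: s)); rewrite /= sz.
case=> t ht; exists (t (false :: nseq (size xs) false)); split.
  have /= := ht (true :: nseq (size xs) false).
  rewrite size_nseq => /(_ erefl).
  by rewrite /koszul_const has_nseq andbF diff_weight0 subr0.
apply: (diff_weight1 xs (fun r => t (false :: r))) => s sz.
by have := ht (false :: s); rewrite /= sz sub0r; apply.
Qed.

End Koszul.

(** * Depth bounds for monomial ideals *)

Section MonomialIdeals.
Local Open Scope ring_scope.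
Variables (k : fieldType) (n : nat).
Implicit Types (M : 'X_{1..n} -> Prop) (I : {mpoly k[n]} -> Prop).
Implicit Types (p q : {mpoly k[n]}) (m : 'X_{1..n}).

Lemma mcoeffMXU p i m :
  (p * 'X_i)@_m = if (0 < m i)%N then p@_(m - U_(i))%MM else 0.
Proof.
case: ifPn => [mi|mi]; last first.
  apply/eqP; rewrite mcoeff_eq0 (perm_mem (msuppMX _ _)).
  by apply/mapP=> -[m' _ mE]; rewrite mE mnmDE mnm1E eqxx in mi.
have le_im : (U_(i) <= m)%MM by rewrite lep1mP -lt0n.
by rewrite -[in LHS](submK le_im) addmC mcoeffMX.
Qed.

Definition upclosed M := forall m m', M m -> M (m + m')%MM.

Definition mono_ideal M p := forall m, m \in msupp p -> M m.

Lemma mono_ideal_ideal M : upclosed M -> is_ideal (mono_ideal M).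
Proof.
move=> hM; split.
- by move=> m; rewrite msupp0.
- move=> p q hp hq m /msuppD_le; rewrite mem_cat => /orP[]; [exact: hp|exact: hq].
- move=> p q hq m /msuppM_le /allpairsP[[m1 m2] /= [_ h2 ->]].
  by rewrite addmC; apply: hM; apply: hq.
Qed.

Lemma mono_idealX M m : mono_ideal M 'X_[m] <-> M m.
Proof.
split; first by apply; rewrite msuppX mem_head.
by move=> Mm m'; rewrite msuppX inE => /eqP->.
Qed.

Lemma ideal_mono I p :
  is_ideal I -> (forall m, m \in msupp p -> I 'X_[m]) -> I p.
Proof.
move=> hI hp; rewrite (mpolyE p); apply: ideal_sum => // m /hp Im.
by rewrite -mul_mpolyC; apply: idealMl.
Qed.

Lemma mono_ideal_adjoin I M (ys : seq 'I_n) p : upclosed M ->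
  (forall p, I p <-> mono_ideal M p) ->
  ideal_adjoin I [seq 'X_y | y <- ys] p <->
  mono_ideal (fun m => M m \/ exists2 y, y \in ys & (0 < m y)%N) p.
Proof.
move=> hM hI; split.
  apply: ideal_adjoin_sub.
  - apply: mono_ideal_ideal => m m' [Mm|[y yy my]]; first by left; apply: hM.
    by right; exists y; rewrite // mnmDE ltn_addr.
  - by move=> q /hI hq m /hq; left.
  - move=> q /mapP[y yy ->]; apply/mono_idealX; right; exists y => //.
    by rewrite mnm1E eqxx.
have hA := ideal_adjoin_ideal I [seq 'X_y | y <- ys].
move=> hp; apply: ideal_mono => // m /hp [Mm|[y yy my]].
  by apply: ideal_adjoin_inclI; apply/hI/mono_idealX.
have le_ym : (U_(y) <= m)%MM by rewrite lep1mP -lt0n.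
rewrite -(submK le_ym) mpolyXD; apply: idealMl => //.
by apply: ideal_adjoin_incl; apply: map_f.
Qed.

Lemma mono_ideal_Xreg M y p : (forall m, M (m + U_(y))%MM -> M m) ->
  mono_ideal M ('X_y * p) -> mono_ideal M p.
Proof.
move=> hy hp m mp; apply/hy/hp.
by rewrite mcoeff_msupp mulrC addmC mcoeffMX -mcoeff_msupp.
Qed.

(** For [m] in the support of [p], the product either contains [m x_o1], or this term cancels
    against [m' x_on] with [m' = m x_o1 / x_on] again in the support. Passing to [m'] lowers the
    exponent of [x_on], so the descent ends. If [x_o1] does not divide [m], then [m x_on] cannot
    cancel, which supplies the other premise of [H2]. *)
Lemma mono_ideal_XBXreg M (o1 on : 'I_n) p : upclosed M -> o1 != on ->
  (forall m, (0 < m o1)%N -> M (m + U_(o1))%MM -> M m) ->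
  (forall m, m o1 = 0%N -> M (m + U_(on))%MM -> M (m + U_(o1))%MM -> M m) ->
  mono_ideal M (('X_o1 - 'X_on) * p) -> mono_ideal M p.
Proof.
move=> hM o1n H1 H2 hp.
have coefE m : (('X_o1 - 'X_on) * p)@_m =
    (if (0 < m o1)%N then p@_(m - U_(o1))%MM else 0)
    - (if (0 < m on)%N then p@_(m - U_(on))%MM else 0).
  by rewrite mulrBl mcoeffB ![_ * p]mulrC !mcoeffMXU.
have shift m : m \in msupp p -> M (m + U_(o1))%MM
    \/ (0 < m on)%N /\ (m + U_(o1) - U_(on))%MM \in msupp p.
  move=> mp; have := coefE (m + U_(o1))%MM.
  rewrite addmK !mnmDE !mnm1E eqxx (negPf o1n) addn1 addn0 ltnS leq0n.
  have [c0|c0 _] := eqVneq ((('X_o1 - 'X_on) * p)@_(m + U_(o1))%MM) 0; last first.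
    by left; apply: hp; rewrite mcoeff_msupp.
  rewrite c0 => /esym/eqP; rewrite subr_eq0 => /eqP E.
  right; case: ifP E => [mn E|_ E]; last by rewrite mcoeff_msupp E eqxx in mp.
  by rewrite mcoeff_msupp -E -mcoeff_msupp.
have shiftM m : (0 < m on)%N -> M (m + U_(o1) - U_(on))%MM -> M (m + U_(o1))%MM.
  move=> mn /(hM _ U_(on)%MM); rewrite submK // lep1mP mnmDE -lt0n.
  by rewrite ltn_addr.
have pos e m : m on = e -> (0 < m o1)%N -> m \in msupp p -> M m.
  elim: e m => [|e IH] m me m1 mp; apply: H1 => //; case: (shift m mp) => //.
    by rewrite me; case.
  case=> mn /IH h; apply: shiftM => //; apply: h.
    by rewrite mnmBE mnmDE !mnm1E eqxx (negPf o1n); lia.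
  by rewrite mnmBE mnmDE !mnm1E eqxx ?[on == o1]eq_sym (negPf o1n); lia.
move=> m mp; have [m1|m1] := posnP (m o1); last exact: pos mp.
apply: H2 => //.
  apply: hp; rewrite mcoeff_msupp coefE !mnmDE !mnm1E eqxx ?[on == o1]eq_sym (negPf o1n).
  rewrite m1 /= addn1 /= addmK sub0r oppr_eq0 -mcoeff_msupp //.
case: (shift m mp) => // -[mn h]; apply: shiftM => //; apply: pos h => //.
by rewrite mnmBE mnmDE !mnm1E eqxx ?[on == o1]eq_sym (negPf o1n); lia.
Qed.

Lemma graded_max_idealP p : graded_max_ideal k n p ->
  exists g : 'I_n -> {mpoly k[n]}, p = \sum_i g i * 'X_i.
Proof.
apply: (@ideal_gen_sub _ _ (fun p => exists g, p = \sum_i g i * 'X_i)).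
- split; first by exists (fun=> 0); rewrite big1 // => i _; rewrite mul0r.
  + move=> q r [g ->] [h ->]; exists (fun i => g i + h i).
    by rewrite -big_split; apply: eq_bigr => i _; rewrite mulrDl.
  + move=> q r [g ->]; exists (fun i => q * g i).
    by rewrite mulr_sumr; apply: eq_bigr => i _; rewrite mulrA.
- move=> q [i ->]; exists (fun j => (j == i)%:R).
  rewrite (bigD1 i) //= eqxx mul1r big1 ?addr0 // => j /negPf->.
  by rewrite mul0r.
Qed.

Lemma mono_depth_ge I M (ys : seq 'I_n) (o1 on : 'I_n) : upclosed M ->
  (forall p, I p <-> mono_ideal M p) -> ~ M 0%MM ->
  uniq ys -> o1 != on -> o1 \notin ys -> on \notin ys ->
  (forall y m, y \in ys -> M (m + U_(y))%MM -> M m) ->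
  (forall m, (0 < m o1)%N -> M (m + U_(o1))%MM -> M m) ->
  (forall m, m o1 = 0%N -> M (m + U_(on))%MM -> M (m + U_(o1))%MM -> M m) ->
  exists s, [/\ forall f, f \in s -> graded_max_ideal k n f,
    regular_on_quotient I s & size s = (size ys).+1].
Proof.
move=> hM hI M0 uys o1n o1y ony Hy H1 H2.
exists (rcons [seq 'X_y | y <- ys] ('X_o1 - 'X_on)).
have hG := ideal_gen_ideal (fun p => exists i : 'I_n, p = 'X_i).
have inG : forall f, f \in rcons [seq 'X_y | y <- ys] ('X_o1 - 'X_on) ->
    graded_max_ideal k n f.
  move=> f; rewrite mem_rcons inE => /orP[/eqP->|/mapP[y _ ->]].
    by apply: idealB => //; apply: ideal_gen_incl; eexists.
  by apply: ideal_gen_incl; eexists.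
split=> //; last by rewrite size_rcons size_map.
have up (zs : seq 'I_n) :
    upclosed (fun m => M m \/ exists2 y, y \in zs & (0 < m y)%N).
  move=> m m' [Mm|[y yy my]]; first by left; apply: hM.
  by right; exists y; rewrite // mnmDE ltn_addr.
split; last first.
  (* Properness: [I] and all members of the sequence lie in the ideal of polynomials without
     constant term. *)
  have hJ : is_ideal (mono_ideal (fun m : 'X_{1..n} => m <> 0%MM)).
    apply: mono_ideal_ideal => m m' m0 /eqP.
    by rewrite mnmD_eq0 => /andP[/eqP].
  have hX i : mono_ideal (fun m : 'X_{1..n} => m <> 0%MM) ('X_i : {mpoly k[n]}).
    by apply/mono_idealX => /eqP; rewrite mnm1_eq0.
  move=> /(ideal_adjoin_sub hJ) H.
  suff : mono_ideal (fun m : 'X_{1..n} => m <> 0%MM) (1 : {mpoly k[n]}).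
    by move=> /(_ 0%MM); rewrite -mpolyC1 msupp1 mem_head => /(_ isT).
  apply: H => [p /hI hp m /hp Mm m0|f /inG].
    by rewrite m0 in Mm.
  by apply: ideal_gen_sub => // _ [i ->].
move=> i g; rewrite size_rcons size_map ltnS leq_eqVlt => /orP[/eqP->|iy].
  rewrite -cats1 take_size_cat ?size_map // nth_cat size_map ltnn subnn /=.
  rewrite !(mono_ideal_adjoin _ _ hM hI).
  apply: mono_ideal_XBXreg => //.
  - move=> m m1 [/H1 Mm|[y yy my]]; first by left; apply: Mm.
    right; exists y => //; move: my; rewrite mnmDE mnm1E.
    by case: eqP => [E|_]; [rewrite E yy in o1y | rewrite addn0].
  - move=> m m1 [Mn|[y yy my]]; last first.
      move=> _; right; exists y => //; move: my; rewrite mnmDE mnm1E.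
      by case: eqP => [E|_]; [rewrite E yy in ony | rewrite addn0].
    move=> [/(H2 _ m1 Mn)|[y yy my]]; first by left.
    right; exists y => //; move: my; rewrite mnmDE mnm1E.
    by case: eqP => [E|_]; [rewrite E yy in o1y | rewrite addn0].
rewrite -cats1 takel_cat ?size_map 1?ltnW // nth_cat size_map iy -map_take.
rewrite (nth_map o1) // !(mono_ideal_adjoin _ _ hM hI).
apply: mono_ideal_Xreg => m [Mm|[y yy my]]; first by left; apply: Hy Mm; apply/mem_nth.
right; exists y => //; move: my; rewrite mnmDE mnm1E.
case: eqP => [E|_]; last by rewrite addn0.
move: yy; rewrite -E => /(nthP o1)[j]; rewrite size_take iy => ji.
rewrite nth_take // => /eqP; rewrite nth_uniq ?(ltn_trans ji) //.
by move/eqP=> ji'; rewrite ji' ltnn in ji.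
Qed.

Let var (i : 'I_n) : {mpoly k[n]} := 'X_i.

(** The monomial times the generators of [ys] and of the one entry that follows them, whence the
    inner [koszul_wedge]. *)
Definition koszul_monomial (ys : seq 'I_n) m : bitseq -> {mpoly k[n]} :=
  foldr (fun=> @koszul_wedge _) (koszul_wedge (koszul_const 'X_[m])) ys.

Lemma koszul_monomial_deg ys m s :
  count id s <> (size ys).+1 -> koszul_monomial ys m s = 0.
Proof.
elim: ys s => [|y ys IH] [|[] s] //= hs; last by apply: IH; lia.
rewrite /koszul_monomial /= /koszul_const has_count; case: ifP => // hs'; lia.
Qed.

Lemma koszul_monomial_cocycle I ys o1 rest m : is_ideal I ->
  (forall i, i \in rest -> I ('X_i * 'X_[m])) ->
  forall s, size s = size (ys ++ o1 :: rest) ->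
  I (koszul_diff var (ys ++ o1 :: rest) (koszul_monomial ys m) s).
Proof.
move=> hI hr; elim: ys => [|y ys IH] /=.
  apply: koszul_wedge_cocycle => // s sz.
  exact: koszul_const_cocycle.
exact: koszul_wedge_cocycle.
Qed.

(** The generators of [ys] are stripped one at a time; from the first step on the ideal is already
    [J]. *)
Lemma koszul_monomial_coboundary I J ys o1 rest m : is_ideal J ->
  (forall p, I p -> J p) -> (forall y, y \in ys -> J 'X_y) ->
  koszul_coboundary var I (ys ++ o1 :: rest) (koszul_monomial ys m) ->
  koszul_coboundary var J (o1 :: rest) (koszul_monomial [::] m).
Proof.
move=> hJ; elim: ys I => [|y ys IH] I IJ Jy /=.
  by case=> t ht; exists t => s /ht/IJ.
move=> h; apply: (IH J) => //.
  by move=> y' yy'; apply: Jy; rewrite inE yy' orbT.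
by apply: koszul_wedge_coboundary h => //; apply: Jy; rewrite mem_head.
Qed.

(* The class of the cochain [z e_1 e_ys] is nonzero: modulo the variables in [ys],
   a cobounding cochain has a component [q] with [x_1 q = z], so [z / x_1] occurs
   in [q], whereas [x_i q] lies in the ideal for all [i] outside [1] and [ys]. *)
Lemma mono_depth_le I M (ys : seq 'I_n) (o1 : 'I_n) (z : 'X_{1..n}) s :
  upclosed M -> (forall p, I p <-> mono_ideal M p) ->
  uniq ys -> o1 \notin ys ->
  (forall i, i != o1 -> i \notin ys -> M (z + U_(i))%MM) ->
  ~ M z -> (forall y, y \in ys -> z y = 0%N) ->
  z o1 = 0%N \/ (exists i, [/\ i != o1, i \notin ys
                  & ~ M (z - U_(o1) + U_(i))%MM]) ->
  (forall f, f \in s -> graded_max_ideal k n f) ->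
  regular_on_quotient I s -> (size s <= (size ys).+1)%N.
Proof.
move=> hM hI uys o1y Mz nMz zy nc sm.
(* Then [ys ++ o1 :: rest] lists every variable once, so each element of the maximal ideal is a
   combination of its entries. *)
set rest := [seq i <- enum 'I_n | (i != o1) && (i \notin ys)].
have restP i : i \in rest = (i != o1) && (i \notin ys).
  by rewrite mem_filter mem_enum andbT.
have hII : is_ideal I.
  have [h0 hD hMl] := mono_ideal_ideal hM; split; first by apply/hI.
    by move=> p q /hI hp /hI hq; apply/hI/hD.
  by move=> p q /hI hq; apply/hI/hMl.
apply: (@koszul_depth_bound _ _ var _ (ys ++ o1 :: rest)) => //; last first.
  move=> f /sm/graded_max_idealP[g ->]; exists g.
  rewrite -big_enum; apply: perm_big; apply: uniq_perm; first exact: enum_uniq.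
    rewrite cat_uniq uys /= negb_or o1y /= restP eqxx /= filter_uniq ?enum_uniq //.
    rewrite andbT; apply/hasPn => i; rewrite restP => /andP[_ ->] //.
  move=> i; rewrite mem_enum mem_cat inE restP.
  by case: (i \in ys); case: eqP.
exists (koszul_monomial ys z); split.
- exact: koszul_monomial_deg.
- apply: koszul_monomial_cocycle => // i; rewrite restP => /andP[i1 iy].
  by rewrite mulrC -mpolyXD; apply/hI/mono_idealX/Mz.
set M' := fun m => M m \/ exists2 y, y \in ys & (0 < m y)%N.
have hM' : upclosed M'.
  move=> m m' [Mm|[y yy my]]; first by left; apply: hM.
  by right; exists y; rewrite // mnmDE ltn_addr.
move=> /(koszul_monomial_coboundary (mono_ideal_ideal hM')) h.
have {h} := koszul_wedge_const_coboundary (h _ _).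
case=> [p /hI hp m /hp|y yy|q [hq1 hq2]]; first by left.
  apply/mono_idealX; right; exists y => //.
  by rewrite mnm1E eqxx.
(* [z] is outside [M'], so it must occur in [x_o1 q] with coefficient 1. *)
have coefq : ('X_[z] - var o1 * q)@_z = 0.
  apply/eqP; rewrite mcoeff_eq0; apply/negP => /hq1 [//|[y yy]].
  by rewrite zy.
move: coefq; rewrite mcoeffB mcoeffX eqxx mulrC mcoeffMXU => coefq.
case: nc => [z1|[i [i1 iy nMi]]].
  by move/eqP: coefq; rewrite z1 subr0 oner_eq0.
move: coefq; case: ifP => z1 /eqP; last by rewrite subr0 oner_eq0.
rewrite subr_eq0 => /eqP q1.
have irest : i \in rest by rewrite restP i1.
have := hq2 i irest (z - U_(o1) + U_(i))%MM.
rewrite mcoeff_msupp mcoeffN oppr_eq0 mulrC addmC mcoeffMX -q1 oner_eq0.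
case=> // [|[y yy]]; first by rewrite addmC.
rewrite mnmDE mnmBE zy // mnm1E.
by case: eqP => [E|//]; rewrite E yy in iy.
Qed.

End MonomialIdeals.

(** * The lexicographic order *)

Section LexOrder.
Variable n : nat.
Implicit Types (w m : 'X_{1..n}) (i j : 'I_n).

Lemma lex_ltP w1 w2 :
  reflect (exists2 i : 'I_n, forall j : 'I_n, j < i -> w1 j = w2 j
                           & w1 i < w2 i)
    (lex_lt w1 w2).
Proof. exact: ltxi_tuplePlt. Qed.

Lemma lex_leNgt w1 w2 : lex_le w1 w2 = ~~ lex_lt w2 w1.
Proof. exact: leNgt. Qed.

Lemma lex_ltW w1 w2 : lex_lt w1 w2 -> lex_le w1 w2.
Proof. exact: ltW. Qed.

Lemma lex_lexx w : lex_le w w.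
Proof. exact: lexx. Qed.

Lemma lex_le_trans w2 w1 w3 : lex_le w1 w2 -> lex_le w2 w3 -> lex_le w1 w3.
Proof. exact: le_trans. Qed.

Lemma lex_ltD m w1 w2 : lex_lt (m + w1)%MM (m + w2)%MM = lex_lt w1 w2.
Proof.
apply/lex_ltP/lex_ltP => -[i hi lti]; exists i => [j /hi|].
- by rewrite !mnmDE => /addnI.
- by rewrite !mnmDE ltn_add2l in lti.
- by rewrite !mnmDE => ->.
- by rewrite !mnmDE ltn_add2l.
Qed.

Lemma lex_leD m w1 w2 : lex_le (m + w1)%MM (m + w2)%MM = lex_le w1 w2.
Proof. by rewrite !lex_leNgt lex_ltD. Qed.

Lemma lex_ltU i j : i < j -> lex_lt U_(j)%MM U_(i)%MM.
Proof.
move=> ij; apply/lex_ltP; exists i.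
  by move=> h hi; rewrite !mnm1E -!val_eqE /= !gtn_eqF // (ltn_trans hi).
by rewrite !mnm1E eqxx -val_eqE /= gtn_eqF.
Qed.

Lemma lex_leU i j : i <= j -> lex_le U_(j)%MM U_(i)%MM.
Proof.
rewrite leq_eqVlt => /orP[/eqP/val_inj->|/lex_ltU/lex_ltW //].
exact: lex_lexx.
Qed.

Lemma lex_le_coord w1 w2 i : lex_le w1 w2 ->
  (forall j : 'I_n, j < i -> w1 j = w2 j) -> w1 i <= w2 i.
Proof.
rewrite lex_leNgt => le12 eq12; rewrite leqNgt; apply: contra le12 => lt21.
by apply/lex_ltP; exists i => // j /eq12.
Qed.

(** Meant for [w2 = u]: a generator agreeing with [u] at [x_1] inherits its zeros between [x_1] and
    [x_l]. *)
Lemma lex_le_eq0 w1 w2 i : lex_le w1 w2 ->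
  (forall j : 'I_n, 0 < j < i -> w2 j = 0) ->
  (forall j : 'I_n, j = 0 :> nat -> w1 j = w2 j) ->
  forall j : 'I_n, 0 < j < i -> w1 j = 0.
Proof.
move=> le12 w20 w10 j; have [e] := ubnP (val j); elim: e j => // e IH j je ji.
suff : w1 j <= 0 by rewrite leqn0 => /eqP.
rewrite -(w20 j ji); apply: lex_le_coord => // h hj.
have [/w10 //|h0] := posnP (val h).
have hi : 0 < h < i by rewrite h0 (ltn_trans hj) //; case/andP: ji.
by rewrite (w20 h hi); apply: IH => //; apply: leq_trans hj _.
Qed.

Lemma mnm_le_mdeg_eq w1 w2 : (w1 <= w2)%MM -> mdeg w2 <= mdeg w1 -> w1 = w2.
Proof.
move=> le12 le21; have /eqP := mdegD (w2 - w1)%MM w1.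
rewrite submK // => /eqP dE; have : mdeg (w2 - w1)%MM == 0 by lia.
by rewrite mdeg_eq0 => /eqP E; rewrite -(submK le12) E add0m.
Qed.

End LexOrder.

(** * Lexsegment ideals *)

Section Lexsegment.
Variables (k : fieldType) (n d : nat) (u v : 'X_{1..n}).
Implicit Types (w m : 'X_{1..n}) (i j : 'I_n).

Definition lexseg_mono m : Prop := exists2 w, lexseg d u v w & (w <= m)%MM.

Lemma lexseg_mono_up : upclosed lexseg_mono.
Proof.
move=> m m' [w hw wm]; exists w => //.
by apply: lepm_trans wm _; apply: lem_addr.
Qed.

Lemma lexseg_idealP (p : {mpoly k[n]}) :
  lexseg_ideal k d u v p <-> mono_ideal lexseg_mono p.
Proof.
split; last first.
  move=> hp; apply: ideal_mono; first exact: ideal_gen_ideal.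
  move=> m /hp[w hw /submK <-]; rewrite mpolyXD.
  apply: idealMl; first exact: ideal_gen_ideal.
  by apply: ideal_gen_incl; exists w.
apply: ideal_gen_sub; first exact/mono_ideal_ideal/lexseg_mono_up.
by move=> _ [w hw ->]; apply/mono_idealX; exists w => //; apply: lepm_refl.
Qed.

Lemma lexseg_mono_mdeg m : lexseg_mono m -> d <= mdeg m.
Proof. by case=> w /and3P[/eqP<- _ _] /submK<-; rewrite mdegD leq_addl. Qed.

Variables (o1 o2 ol on : 'I_n).
Hypotheses (o1E : val o1 = 0) (o2E : val o2 = 1) (onE : val on = n.-1).
Hypotheses (ol_gt0 : 0 < ol) (hd : 2 <= d).
Hypotheses (u1 : u o1 = 1) (u0 : forall i, 0 < i < ol -> u i = 0).
Hypotheses (ul : 0 < u ol) (v1 : v o1 = 0).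
Hypotheses (hdu : mdeg u = d) (hdv : mdeg v = d).
Hypothesis huv : lex_lt (U_(on) + (u - U_(o1)))%MM v.

Let le_on i : i <= on.
Proof. by rewrite onE -ltnS prednK // (leq_ltn_trans _ (ltn_ord i)). Qed.

Let eq_o1 i : val i = 0 -> i = o1.
Proof. by move=> E; apply: val_inj; rewrite E. Qed.

Let n_gt1 : 1 < n. Proof. by rewrite -o2E ltn_ord. Qed.

Let o12 : o1 != o2. Proof. by rewrite -val_eqE /= o1E o2E. Qed.
Let o1n : o1 != on. Proof. by rewrite -val_eqE /= o1E onE; lia. Qed.
Let o1l : o1 != ol. Proof. by rewrite -val_eqE /= o1E; lia. Qed.

Let uK : (u - U_(o1) + U_(o1))%MM = u.
Proof. by rewrite submK // lep1mP u1. Qed.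

Lemma lexseg_coord1 w : lexseg d u v w -> w o1 <= 1.
Proof.
case/and3P=> _ wu _; rewrite -u1; apply: lex_le_coord wu _ => j.
by rewrite o1E.
Qed.

(** [u] and [v] have exponents 1 and 0 at [x_1], so here and in [lexseg_high] one of the two
    comparisons is automatic. *)
Lemma lexseg_low w : w o1 = 1 -> mdeg w = d -> lex_le w u -> lexseg d u v w.
Proof.
move=> w1 wd wu; rewrite /lexseg wd eqxx wu /=; apply/lex_ltW/lex_ltP.
by exists o1; [move=> j; rewrite o1E|rewrite w1 v1].
Qed.

Lemma lexseg_high w : w o1 = 0 -> mdeg w = d -> lex_le v w -> lexseg d u v w.
Proof.
move=> w1 wd vw; rewrite /lexseg wd eqxx vw andbT /=; apply/lex_ltW/lex_ltP.
by exists o1; [move=> j; rewrite o1E|rewrite w1 u1].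
Qed.

Lemma lexseg_mono_reg1 m :
  0 < m o1 -> lexseg_mono (m + U_(o1))%MM -> lexseg_mono m.
Proof.
move=> m1 [w hw /mnm_lepP wm]; exists w => //; apply/mnm_lepP => i.
have := wm i; rewrite mnmDE mnm1E; case: eqP => [<- _|_]; last by rewrite addn0.
exact: leq_trans (lexseg_coord1 hw) m1.
Qed.

Lemma lem_subU m w i : (w <= m + U_(i))%MM -> (w - U_(i) <= m)%MM.
Proof.
move=> /mnm_lepP wm; apply/mnm_lepP => j; have := wm j.
by rewrite mnmDE mnmBE; lia.
Qed.

Lemma lem_addU m w i : (w <= m + U_(i))%MM -> w i <= m i -> (w <= m)%MM.
Proof.
move=> /mnm_lepP wm wmi; apply/mnm_lepP => j; have := wm j.
by rewrite mnmDE mnm1E; case: eqP => [<- //|_]; rewrite addn0.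
Qed.

(** Let generators [w] and [w2] divide [m x_n] and [m x_1] but not [m]. If [w / x_n] is a proper
    divisor of [m], trading [x_n] for a missing [x_i] gives a generator that divides [m]. Otherwise
    [m = w / x_n = w2 / x_1], and [x_n u / x_1 < v <= w] yields [u < w2], a contradiction. *)
Lemma lexseg_mono_regn m : m o1 = 0 ->
  lexseg_mono (m + U_(on))%MM -> lexseg_mono (m + U_(o1))%MM -> lexseg_mono m.
Proof.
move=> m1 [w hw wm] [w2 hw2 w2m].
have [wmn|wmn] := leqP (w on) (m on).
  by exists w => //; apply: lem_addU wm wmn.
have [w2m1|w2m1] := leqP (w2 o1) (m o1).
  by exists w2 => //; apply: lem_addU w2m w2m1.
have w21 : w2 o1 = 1 by have := lexseg_coord1 hw2; lia.
case/and3P: hw => /eqP wd _ vw; case/and3P: hw2 => /eqP w2d w2u _.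
have wK : (w - U_(on) + U_(on))%MM = w by rewrite submK // lep1mP; lia.
have w2K : (w2 - U_(o1) + U_(o1))%MM = w2 by rewrite submK // lep1mP; lia.
have {}wm := lem_subU wm; have {}w2m := lem_subU w2m.
have wd1 : mdeg (w - U_(on))%MM = d.-1.
  by rewrite -wd -[in RHS]wK mdegD mdeg1 addn1.
have w2d1 : mdeg (w2 - U_(o1))%MM = d.-1.
  by rewrite -w2d -[in RHS]w2K mdegD mdeg1 addn1.
have [[i wmi]|nwm] : (exists i, (w - U_(on))%MM i < m i) \/ (w - U_(on))%MM = m.
  have [/existsP[i wi]|/existsPn H] := boolP [exists i, (w - U_(on))%MM i < m i].
    by left; exists i.
  right; apply/mnmP => i; apply/eqP; rewrite eqn_leq (mnm_lepP wm) /=.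
  by rewrite leqNgt H.
  have le3 : (w - U_(on) + U_(i) <= m)%MM.
    apply/mnm_lepP => j; rewrite mnmDE mnm1E.
    by case: eqP => [<-|_]; rewrite ?addn1 // addn0; apply/mnm_lepP.
  exists (w - U_(on) + U_(i))%MM => //; apply: lexseg_high.
  - by apply/eqP; rewrite -leqn0 -m1; apply/mnm_lepP.
  - by rewrite mdegD wd1 mdeg1; lia.
  - by apply: lex_le_trans vw _; rewrite -{1}wK lex_leD lex_leU.
have E2 : (w2 - U_(o1))%MM = m.
  by apply: mnm_le_mdeg_eq => //; rewrite w2d1 -nwm wd1.
have : lex_lt (U_(on) + (u - U_(o1)))%MM (U_(on) + m)%MM.
  by rewrite [(_ + m)%MM]addmC -nwm wK; apply: lt_le_trans huv vw.
rewrite lex_ltD -E2 -(lex_ltD U_(o1)%MM) ![(U_(o1) + _)%MM]addmC w2K uK.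
by move=> uw2; move: w2u; rewrite lex_leNgt uw2.
Qed.
(** A generator containing [x_1] has no variable between [x_1] and [x_l], by comparison with [u].
    One free of [x_1] has degree at least [d - 1] in [x_2], so if it involves [x_y] it equals
    [x_2^(d-1) x_y], which is less than [v]. *)
Lemma lexseg_mono_reg (oj y : 'I_n) m :
  v = (U_(o2) *+ d.-1 + U_(oj))%MM -> 0 < oj -> oj < y < ol ->
  lexseg_mono (m + U_(y))%MM -> lexseg_mono m.
Proof.
move=> vE oj0 /andP[jy yl] [w hw wm]; exists w => //; apply: lem_addU wm _.
suff -> : w y = 0 by [].
have w1le := lexseg_coord1 hw; case/and3P: hw => /eqP wd wu vw.
have [w1|w1] := posnP (w o1); last first.
  apply: (lex_le_eq0 (i := ol) wu) => //; last by rewrite yl (leq_trans _ jy).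
  by move=> j /eq_o1 ->; lia.
apply/eqP; rewrite -leqn0 leqNgt; apply/negP => wy.
have w2 : d.-1 <= w o2.
  apply: (@leq_trans (v o2)).
    by rewrite vE mnmDE mulmnE mnm1E eqxx mul1n leq_addr.
  apply: lex_le_coord vw _ => j; rewrite o2E ltnS leqn0.
  by move=> /eqP/eq_o1->; rewrite v1 w1.
have wE : (U_(o2) *+ d.-1 + U_(y))%MM = w.
  apply: mnm_le_mdeg_eq; last by rewrite mdegD mdegMn !mdeg1 wd; lia.
  apply/mnm_lepP => i; rewrite mnmDE mulmnE !mnm1E.
  have [<-|_] := eqVneq o2 i; last by case: eqP => [<-|].
  by rewrite -val_eqE /= o2E mul1n; case: eqP; lia.
by move: vw; rewrite lex_leNgt -wE vE lex_ltD lex_ltU.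
Qed.

Lemma lexseg_depth_ge (ys : seq 'I_n) : uniq ys -> o1 \notin ys -> on \notin ys ->
  (forall y m, y \in ys -> lexseg_mono (m + U_(y))%MM -> lexseg_mono m) ->
  exists s, [/\ forall f, f \in s -> graded_max_ideal k n f,
    regular_on_quotient (lexseg_ideal k d u v) s & size s = (size ys).+1].
Proof.
move=> uys o1y ony Hy.
apply: (mono_depth_ge lexseg_mono_up lexseg_idealP _ uys o1n o1y ony Hy).
- by move/lexseg_mono_mdeg; rewrite mdeg0; lia.
- exact: lexseg_mono_reg1.
- exact: lexseg_mono_regn.
Qed.

Lemma lexseg_depth1 z :
  (forall i, i != o1 -> lexseg_mono (z + U_(i))%MM) -> ~ lexseg_mono z ->
  z o1 = 0 \/ (exists i, i != o1 /\ ~ lexseg_mono (z - U_(o1) + U_(i))%MM) ->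
  depth_is (lexseg_ideal k d u v) 1.
Proof.
move=> Mz nMz nc; split; first exact: (@lexseg_depth_ge [::]).
move=> s; apply: (mono_depth_le (ys := [::]) (o1 := o1) lexseg_mono_up lexseg_idealP _ _ _ nMz) => //.
- by move=> i i1 _; apply: Mz.
- by case: nc => [->|[i [i1 ni]]]; [left|right; exists i].
Qed.

(** [x_2^(d-1)] has too low a degree to lie in the ideal, while each [x_2^(d-1) x_i] with [i >= 2]
    is at least [v]. *)
Lemma lexseg_depth_small_v :
  lex_le v (U_(o2) *+ d.-1 + U_(on))%MM -> depth_is (lexseg_ideal k d u v) 1.
Proof.
move=> vle; apply: (@lexseg_depth1 (U_(o2) *+ d.-1)%MM).
- move=> i i1; exists (U_(o2) *+ d.-1 + U_(i))%MM; last exact: lepm_refl.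
  apply: lexseg_high.
  + by rewrite mnmDE mulmnE !mnm1E [o2 == o1]eq_sym (negPf o12) (negPf i1).
  + by rewrite mdegD mdegMn !mdeg1; lia.
  + by apply: lex_le_trans vle _; rewrite lex_leD lex_leU.
- by move/lexseg_mono_mdeg; rewrite mdegMn mdeg1; lia.
- by left; rewrite mulmnE mnm1E [o2 == o1]eq_sym (negPf o12).
Qed.

Lemma lexseg_depth_l2 : val ol = 1 -> depth_is (lexseg_ideal k d u v) 1.
Proof.
move=> ol1; have ulK : (u - U_(ol) + U_(ol))%MM = u by rewrite submK // lep1mP -lt0n.
have ud : mdeg (u - U_(ol))%MM = d.-1.
  by rewrite -hdu -[in RHS]ulK mdegD mdeg1 addn1.
apply: (@lexseg_depth1 (u - U_(ol))%MM).
- move=> i i1; exists (u - U_(ol) + U_(i))%MM; last exact: lepm_refl.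
  apply: lexseg_low.
  + by rewrite mnmDE mnmBE !mnm1E u1 (negPf i1) [ol == o1]eq_sym (negPf o1l).
  + by rewrite mdegD ud mdeg1; lia.
  + rewrite -{2}ulK lex_leD lex_leU // ol1 lt0n.
    by apply: contra i1 => /eqP/eq_o1->.
- by move/lexseg_mono_mdeg; rewrite ud; lia.
(* Dividing by [x_1] and multiplying by [x_2] keeps the degree at [d - 1], too low for the ideal. *)
- right; exists o2; rewrite eq_sym o12; split=> // /lexseg_mono_mdeg.
  have zK : (u - U_(ol) - U_(o1) + U_(o1))%MM = (u - U_(ol))%MM.
    by rewrite submK // lep1mP mnmBE mnm1E u1 [ol == o1]eq_sym (negPf o1l).
  by move: ud; rewrite -{1}zK !mdegD !mdeg1; lia.
Qed.

Variable oj : 'I_n.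
Hypothesis vE : v = (U_(o2) *+ d.-1 + U_(oj))%MM.
Hypotheses (oj_gt0 : 0 < oj) (ojn : oj < on) (ol_gt1 : 1 < ol).

(** The exponent [e] lets one statement serve both [z] and [z x_n / x_1]. A generator containing
    [x_1] avoids [x_2], so it divides [x_1 m], whose degree is below [d]; one free of [x_1] is
    [x_2^(d-1) x_i] with [x_i] dividing [m], so [i > j] and it is less than [v]. *)
Lemma lexseg_mono_socle e m : e <= 1 ->
  (forall i : 'I_n, (i <= oj) || (i < ol) -> m i = 0) -> e = 0 \/ mdeg m <= d - 2 ->
  ~ lexseg_mono (U_(o1) *+ e + U_(o2) *+ d.-1 + m)%MM.
Proof.
move=> e1 m0 em [w hw /mnm_lepP wm].
have w1le := lexseg_coord1 hw; case/and3P: hw => /eqP wd wu vw.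
have m1 : m o1 = 0 by apply: m0; rewrite o1E.
have m2 : m o2 = 0 by apply: m0; rewrite o2E ol_gt1 orbT.
have [w1|w1] := posnP (w o1); last first.
  have e0 : e = 1.
    have := wm o1; rewrite !mnmDE !mulmnE !mnm1E m1 eqxx.
    by rewrite [o2 == o1]eq_sym (negPf o12); lia.
  case: em => [|md]; first by rewrite e0.
  have w2 : w o2 = 0.
    apply: (lex_le_eq0 (i := ol) wu) => //; last by rewrite o2E ol_gt1.
    by move=> j /eq_o1 ->; lia.
  have : (w <= U_(o1) + m)%MM.
    apply/mnm_lepP => i; have := wm i; rewrite !mnmDE !mulmnE !mnm1E e0 muln1.
    by case: (eqVneq o2 i) => [<-|_]; rewrite ?w2 // mul0n addn0.
  by move/submK/(congr1 (@mdeg n)); rewrite !mdegD mdeg1 wd; lia.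
have w2 : d.-1 <= w o2.
  apply: (@leq_trans (v o2)).
    by rewrite vE mnmDE mulmnE mnm1E eqxx mul1n leq_addr.
  apply: lex_le_coord vw _ => j; rewrite o2E ltnS leqn0.
  by move=> /eqP/eq_o1->; rewrite v1 w1.
have wK : (w - U_(o2) *+ d.-1 + U_(o2) *+ d.-1)%MM = w.
  rewrite submK //; apply/mnm_lepP => i; rewrite mulmnE mnm1E.
  by case: eqP => [<-|]; rewrite ?mul1n.
have /mdeg1P[i /eqP wi] : mdeg (w - U_(o2) *+ d.-1)%MM == 1.
  by move: wd; rewrite -wK mdegD mdegMn mdeg1 addmK => wd; apply/eqP; lia.
rewrite wi in wK; have i1 : i != o1.
  by apply: contra_eq_neq w1 => E; rewrite -wK E mnmDE mnm1E eqxx.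
have mi : 0 < m i.
  have := wm i; rewrite -wK !mnmDE !mulmnE !mnm1E eqxx [o1 == i]eq_sym (negPf i1).
  by lia.
have ji : oj < i.
  by rewrite ltnNge; apply: contraL mi => ij; rewrite m0 ?ij.
by move: vw; rewrite lex_leNgt -wK vE [(U_(i) + _)%MM]addmC lex_ltD lex_ltU.
Qed.

Lemma lexseg_depth_of_socle m : mdeg m = d - 2 ->
  (forall i : 'I_n, (i <= oj) || (i < ol) -> m i = 0) ->
  (forall i : 'I_n, oj < i -> ol <= i -> lex_le (U_(o1) + (m + U_(i)))%MM u) ->
  depth_is (lexseg_ideal k d u v)
    (size [seq i : 'I_n <- enum 'I_n | oj < i < ol]).+1.
Proof.
move=> md m0 mu; set ys := [seq i <- _ | _].
have yP (i : 'I_n) : (i \in ys) = (oj < i < ol) by rewrite mem_filter mem_enum andbT.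
have uys : uniq ys by rewrite filter_uniq ?enum_uniq.
have o1y : o1 \notin ys by rewrite yP o1E.
have ony : on \notin ys by rewrite yP [on < ol]ltnNge le_on andbF.
have m1 : m o1 = 0 by apply: m0; rewrite o1E.
have ol_le_on := le_on ol.
split.
  apply: lexseg_depth_ge => // y m'; rewrite yP.
  exact: lexseg_mono_reg.
move=> s; apply: (mono_depth_le (ys := ys) (o1 := o1)
  (z := (U_(o1) *+ 1 + U_(o2) *+ d.-1 + m)%MM)
  lexseg_mono_up lexseg_idealP uys o1y).
- move=> i i1; rewrite yP => iy.
  have i0 : 0 < i by rewrite lt0n; apply: contra i1 => /eqP/eq_o1->.
  (* For [i <= j] the product is divisible by [x_2^(d-1) x_i >= v], and for [i >= l] by
     [x_1 m x_i <= u]. *)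
  have [ij|ij] := leqP i oj.
    exists (U_(o2) *+ d.-1 + U_(i))%MM; last first.
      by apply/mnm_lepP => h; rewrite !mnmDE; lia.
    apply: lexseg_high.
    + by rewrite mnmDE mulmnE !mnm1E [o2 == o1]eq_sym (negPf o12) (negPf i1).
    + by rewrite mdegD mdegMn !mdeg1; lia.
    + by rewrite vE lex_leD lex_leU.
  have li : ol <= i by rewrite ij /= -leqNgt in iy.
  exists (U_(o1) + (m + U_(i)))%MM; last first.
    by apply/mnm_lepP => h; rewrite !mnmDE mulm1n; lia.
  apply: lexseg_low; last exact: mu.
  + by rewrite !mnmDE !mnm1E eqxx m1 (negPf i1).
  + by rewrite !mdegD !mdeg1 md; lia.
- by apply: lexseg_mono_socle => //; right; rewrite md.
- move=> y; rewrite yP => /andP[jy yl].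
  rewrite !mnmDE !mulmnE !mnm1E m0 ?yl ?orbT // -!val_eqE /= o1E o2E.
  by case: eqP => E; [lia|case: eqP => E'; lia].
(* Here [z x_n / x_1] is the case [e = 0], with [m x_n] in place of [m]. *)
- right; exists on; rewrite eq_sym o1n ony; split=> //.
  have -> : (U_(o1) *+ 1 + U_(o2) *+ d.-1 + m - U_(o1) + U_(on))%MM
          = (U_(o1) *+ 0 + U_(o2) *+ d.-1 + (m + U_(on)))%MM.
    apply/mnmP => i; rewrite !mnmDE mnmBE !mnmDE !mulmnE !muln0 muln1.
    by rewrite -addnA addKn addnA.
  apply: lexseg_mono_socle => // [i ijl|]; last by left.
  rewrite mnmDE m0 // mnm1E; case: eqP => // E; move: ijl; rewrite -E.
  by rewrite leqNgt ojn ltnNge ol_le_on.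
Qed.

Lemma lexseg_depth_large_v :
  depth_is (lexseg_ideal k d u v)
    (size [seq i : 'I_n <- enum 'I_n | oj < i < ol]).+1.
Proof.
have [jl|lj] := ltnP oj ol.
  have ulK : (u - U_(o1) - U_(ol) + U_(ol))%MM = (u - U_(o1))%MM.
    by rewrite submK // lep1mP mnmBE mnm1E (negPf o1l); lia.
  apply: (@lexseg_depth_of_socle (u - U_(o1) - U_(ol))%MM).
  - have := congr1 (@mdeg n) uK; have := congr1 (@mdeg n) ulK.
    by rewrite !mdegD !mdeg1 hdu; lia.
  - move=> i hi; rewrite !mnmBE.
    have [/eq_o1->|i0] := posnP (val i); first by rewrite u1 mnm1E eqxx.
    by rewrite u0 // i0 /=; case/orP: hi => // /leq_ltn_trans; apply.
  - move=> i _ li; rewrite -[X in lex_le _ X]uK.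
    rewrite -[in X in lex_le _ X]ulK [(_ + U_(o1))%MM]addmC.
    by rewrite !lex_leD lex_leU.
apply: (@lexseg_depth_of_socle (U_(on) *+ (d - 2))%MM).
- by rewrite mdegMn mdeg1 mul1n.
- move=> i hi; rewrite mulmnE mnm1E; case: eqP => // E; move: hi.
  by rewrite -E [on <= _]leqNgt ojn [on < _]ltnNge le_on.
(* Both monomials agree before [x_l], and since [l <= j < i] and [j < n], only [u] involves
   [x_l]. *)
- move=> i ji li; apply: lex_ltW; apply/lex_ltP; exists ol.
    move=> h hl; rewrite !mnmDE mulmnE !mnm1E.
    have hi : i == h = false by rewrite -val_eqE /= gtn_eqF // (leq_trans hl).
    have hn : on == h = false.
      by rewrite -val_eqE /= gtn_eqF // (leq_trans hl) // le_on.
    rewrite hi hn; have [/eq_o1->|h0] := posnP (val h); first by rewrite eqxx u1.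
    rewrite u0 ?h0 //; case: eqP => // E; by rewrite -E o1E in h0.
  rewrite !mnmDE mulmnE !mnm1E (negPf o1l).
  have -> : i == ol = false by rewrite -val_eqE /= gtn_eqF // (leq_ltn_trans lj).
  have -> : on == ol = false by rewrite -val_eqE /= gtn_eqF // (leq_ltn_trans lj).
  by [].
Qed.

End Lexsegment.

(** * Coordinates of the given monomials and the three cases *)

Lemma xm_ord n (i : 'I_n) : xm n i.+1 = U_(i)%MM.
Proof. by apply/mnmP => j; rewrite mnmE mnm1E eq_sym. Qed.

Lemma sum_xmE n l (a : nat -> nat) (i : 'I_n) :
  (\sum_(l <= j < n.+1) xm n j *+ a j)%MM i = if l <= i.+1 then a i.+1 else 0.
Proof.
rewrite mnm_sumE; under eq_bigr => j _ do rewrite mulmnE mnmE.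
case: ifP => li.
  rewrite (bigD1_seq i.+1) ?iota_uniq ?mem_index_iota ?li ?ltnS //=.
  by rewrite eqxx mul1n big1 ?addn0 // => j /negPf; rewrite eq_sym => ->.
rewrite big_nat_cond big1 // => j /andP[/andP[lj _] _].
by case: eqP => // E; rewrite -E li in lj.
Qed.

Lemma size_filter_ord n a b : b <= n ->
  size [seq i : 'I_n <- enum 'I_n | a < i < b] = b - a.+1.
Proof.
move=> bn; rewrite -(size_map val) -(filter_map val (fun i => a < i < b)).
(* Capping [b] at [n] removes the bound from the induction on [n]. *)
rewrite val_enum_ord size_filter -[b in RHS](minn_idPr bn) {bn}.
elim: n => [|m IH]; first by rewrite min0n.
by rewrite -[m.+1]addn1 iotaD count_cat IH /= addn0 add0n; lia.
Qed.

Theorem proposition2p3p7 (k : fieldType) (n d : nat) (hd : 2 <= d)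
    (l q : nat) (hl : 2 <= l <= n) (hq : 2 <= q <= n)
    (a b : nat -> nat) (ha : 0 < a l) (hb : 0 < b q)
    (u v : 'X_{1..n})
    (hu : u = (xm n 1 + \sum_(l <= i < n.+1) xm n i *+ a i)%MM)
    (hv : v = (\sum_(q <= i < n.+1) xm n i *+ b i)%MM)
    (hdu : mdeg u = d) (hdv : mdeg v = d)
    (huv : lex_lt (xm n n + (u - xm n 1))%MM v) :
  [/\ (v = (xm n 2 *+ d)%MM -> 4 <= l ->
         depth_is (lexseg_ideal k d u v) (l - 2)),
      (forall j : nat, 3 <= j <= n - 2 ->
         v = (xm n 2 *+ (d - 1) + xm n j)%MM -> j + 2 <= l ->
         depth_is (lexseg_ideal k d u v) (l - j))
    & (~ (v = (xm n 2 *+ d)%MM /\ 4 <= l) ->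
       ~ (exists j : nat, [/\ 3 <= j <= n - 2,
            v = (xm n 2 *+ (d - 1) + xm n j)%MM & j + 2 <= l]) ->
       depth_is (lexseg_ideal k d u v) 1)].
Proof.
have [n1 n2 ln nn] : [/\ 0 < n, 1 < n, l.-1 < n & n.-1 < n] by split; lia.
pose o1 := Ordinal n1; pose o2 := Ordinal n2.
pose ol := Ordinal ln; pose on := Ordinal nn.
have xm1 : xm n 1 = U_(o1)%MM by rewrite -xm_ord.
have xm2 : xm n 2 = U_(o2)%MM by rewrite -xm_ord.
have xmn : xm n n = U_(on)%MM by rewrite -xm_ord /= prednK.
have uE i : u i = (o1 == i) + if l <= i.+1 then a i.+1 else 0.
  by rewrite hu mnmDE xm1 mnm1E sum_xmE.
have u1 : u o1 = 1 by rewrite uE eqxx; case: ifP => //=; lia.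
have u0 (i : 'I_n) : 0 < i < ol -> u i = 0.
  move=> /andP[i0 il]; rewrite uE -val_eqE /= eq_sym gtn_eqF //.
  by case: ifP => //; move: il => /=; lia.
have ul : 0 < u ol by rewrite uE /= prednK ?leqnn; lia.
have v1 : v o1 = 0 by rewrite hv sum_xmE /=; case: ifP => //; lia.
have ol0 : 0 < ol by rewrite /=; lia.
rewrite xm1 xmn in huv; rewrite xm2 subn1.
(* Ordinals are zero-based: [j = oj + 1] and [l = ol + 1]. The value is [l - j] if [l > j], and
   truncated subtraction makes it 1 otherwise. *)
have large (oj : 'I_n) : v = (U_(o2) *+ d.-1 + U_(oj))%MM -> 0 < oj -> oj < n.-1 ->
    1 < ol -> depth_is (lexseg_ideal k d u v) (ol - oj.+1).+1.
  move=> vE oj0 ojn ol1; rewrite -(@size_filter_ord n); last exact: ltnW.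
  exact: (@lexseg_depth_large_v k n d u v o1 o2 ol on).
have dE : (U_(o2) *+ d)%MM = (U_(o2) *+ d.-1 + U_(o2))%MM.
  by rewrite -mulmSr prednK // ltnW.
split=> [|j jn|nA nB].
- rewrite dE => vE l4.
  have -> : l - 2 = (ol - o2.+1).+1 by rewrite /=; lia.
  by apply: large => //=; lia.
- have jn' : j.-1 < n by lia.
  have xmj : xm n j = U_(Ordinal jn')%MM by rewrite -xm_ord /= prednK //; lia.
  rewrite xmj => vE jl.
  have -> : l - j = (ol - (Ordinal jn').+1).+1 by rewrite /=; lia.
  by apply: large => //=; lia.
have [vle|] := boolP (lex_le v (U_(o2) *+ d.-1 + U_(on))%MM).
  exact: (@lexseg_depth_small_v k n d u v o1 o2 ol on).
rewrite lex_leNgt negbK => vgt.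
have [l2|l2] := eqVneq (val ol) 1.
  exact: (@lexseg_depth_l2 k n d u v o1 o2 ol on).
(* Now [v > x_2^(d-1) x_n], which forces [v = x_2^(d-1) x_j] with [2 <= j < n]. *)
have v2 : d.-1 <= v o2.
  apply: (@leq_trans ((U_(o2) *+ d.-1 + U_(on))%MM o2)).
    by rewrite mnmDE mulmnE mnm1E eqxx mul1n leq_addr.
  apply: (lex_le_coord (lex_ltW vgt)) => i; rewrite ltnS leqn0 => /eqP i0.
  rewrite [i](_ : _ = o1) ?v1 ?mnmDE ?mulmnE ?mnm1E; last exact: val_inj.
  by rewrite -!val_eqE /= gtn_eqF //; lia.
have vK : (v - U_(o2) *+ d.-1 + U_(o2) *+ d.-1)%MM = v.
  rewrite submK //; apply/mnm_lepP => i; rewrite mulmnE mnm1E.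
  by case: eqP => [<-|]; rewrite ?mul1n.
have /mdeg1P[oj /eqP vj] : mdeg (v - U_(o2) *+ d.-1)%MM == 1.
  by move: hdv; rewrite -{1}vK mdegD mdegMn mdeg1; lia.
rewrite vj addmC in vK.
have oj0 : 0 < oj.
  rewrite lt0n; apply: contra_eq_neq v1 => oj0.
  by rewrite -vK mnmDE [o1](_ : _ = oj) ?mnm1E ?eqxx; [lia|apply: val_inj].
have ojn : oj < n.-1.
  have : oj <= n.-1 by have := ltn_ord oj; lia.
  rewrite leq_eqVlt => /orP[/eqP jn|//].
  move: vgt; rewrite -vK [oj](_ : _ = on); last exact: val_inj.
  by rewrite -[lex_lt _ _]negbK -lex_leNgt lex_lexx.
(* A value [l > j + 1] would be case (a) if [j = 2] and case (b) if [j >= 3], where [j <= n - 2]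
   follows from [l <= n]. *)
have -> : 1 = (ol - oj.+1).+1.
  suff : l <= oj.+2 by rewrite /=; lia.
  rewrite leqNgt; apply/negP => jl.
  have [j1|j1] := eqVneq (oj : nat) 1.
    apply: nA; split; last by lia.
    by rewrite dE -vK; congr (_ + U_(_))%MM; apply: val_inj.
  apply: nB; exists oj.+1; split; [lia| |lia].
  by rewrite xm_ord vK.
by apply: large => //; move: l2 ol0 => /=; lia.
Qed.
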